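(* (a) There exists a unique $\mathbf{Z}$-linear map $\overline{\phantom{x}}: M\to M$ such that $\overline{hm}=\overline{h}\,\overline{m}$ for all $h\in\mathfrak{H}$, $m\in M$, and $\overline{a_1}=a_1$. For any $m\in M$ we have $\overline{\overline{m}}=m$. (b) For any $w\in\mathbf{I}_*$ we have $\overline{a_w}=\epsilon_w T_{w^{-1}}^{-1}a_{w^{-1}}$.
   Context: $W$ is a Coxeter group with set of simple reflections $S$, length function $l:W\to\mathbf{N}$ and Bruhat order $\le$; $\epsilon_x=(-1)^{l(x)}$ for $x\in W$. $w\mapsto w^*$ is an automorphism of $W$ with square $1$ which leaves $S$ stable. $\mathbf{I}_*=\{w\in W : (w^* )^{-1}=w\}$. $u$ is an indeterminate and $\mathcal{A}=\mathbf{Z}[u,u^{-1}]$. $\mathfrak{H}$ is the free $\mathcal{A}$-module with basis $(T_w)_{w\in W}$ with the unique $\mathcal{A}$-algebra structure with unit $T_1$ such that $T_wT_{w'}=T_{ww'}$ if $l(ww')=l(w)+l(w')$, and $(T_s+1)(T_s-u^2)=0$ for all $s\in S$. $\overline{\phantom{x}}:\mathfrak{H}\to\mathfrak{H}$ is the unique ring involution such that $\overline{u^nT_x}=u^{-n}T_{x^{-1}}^{-1}$ for any $x\in W$, $n\in\mathbf{Z}$. $M$ is the free $\mathcal{A}$-module with basis $\{a_w : w\in\mathbf{I}_*\}$, with its unique $\mathfrak{H}$-module structure such that for $s\in S$, $w\in\mathbf{I}_*$: $T_s a_w = u a_w + (u+1)a_{sw}$ if $sw = ws^* > w$; $T_s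 a_w = (u^2-u-1)a_w + (u^2-u)a_{sw}$ if $sw = ws^* < w$; $T_s a_w = a_{sws^*}$ if $sw\ne ws^*$, $sw > w$; $T_s a_w = (u^2-1)a_w + u^2 a_{sws^*}$ if $sw\ne ws^*$, $sw < w$. *)

(* Defs.v *)
From HB Require Import structures.
From Stdlib Require Import Relation_Operators.
From mathcomp Require Import all_boot all_order all_algebra.
From mathcomp Require Import fraction finmap boolp.

Set Implicit Arguments.
Unset Strict Implicit.
Unset Printing Implicit Defensive.

Import GRing.Theory.
Local Open Scope ring_scope.

(* A word is a sequence of elements of S.  Every generator is its own inverse, so
   the group presented by the relations (st)^m = 1 is the quotient of the monoid
   of words by the congruence generated by those relations; [cox_congr] is this
   congruence.  Here m ranges over all exponents with (st)^m = 1 in W, which are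
   the multiples of the order of st if that order is finite, and only 0 otherwise. *)
Section Words.
Variables (W : groupType) (S : {pred W}).

Definition word_prod (ws : seq W) : W := (\prod_(x <- ws) x)%g.

Definition cox_step (v w : seq W) : Prop :=
  exists (p q : seq W) (s t : W) (m : nat),
    [/\ s \in S, t \in S, ((s * t) ^+ m = 1)%g,
        v = p ++ q & w = p ++ flatten (nseq m [:: s; t]) ++ q].

Definition cox_congr : seq W -> seq W -> Prop := clos_refl_sym_trans _ cox_step.

End Words.

Record coxeterSystem := CoxeterSystem {
  cox_group :> groupType;
  simple : {pred cox_group};
  simple_neq1 : forall s, s \in simple -> s <> 1%g;
  simple_invol : forall s, s \in simple -> (s * s = 1)%g;
  simple_gen : forall w, exists2 ws, all (mem simple) ws & word_prod ws = w;
  simple_presentation : forall v w,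
    all (mem simple) v -> all (mem simple) w ->
    word_prod v = word_prod w -> cox_congr simple v w
}.

Section Coxeter.
Variable W : coxeterSystem.

Definition has_word (w : W) (n : nat) : bool :=
  `[< exists ws, [/\ all (mem (simple (c := W))) ws, word_prod ws = w & size ws = n] >].

Fact has_word_ex (w : W) : exists n, has_word w n.
Proof.
have [ws Sws ws_w] := simple_gen w.
by exists (size ws); apply/asboolP; exists ws; split.
Qed.

Definition length (w : W) : nat := ex_minn (has_word_ex w).

Definition reflection (t : W) : Prop :=
  exists2 s, s \in simple (c := W) & exists x : W, t = (x * s * x^-1)%g.

Definition bruhat_step (x y : W) : Prop :=
  exists2 t, reflection t & y = (x * t)%g /\ (length x < length y)%N.

Definition bruhat_le : W -> W -> Prop := clos_refl_trans _ bruhat_step.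

Definition bruhat_lt (x y : W) : Prop := bruhat_le x y /\ x <> y.

Definition diagram_involution (star : W -> W) : Prop :=
  [/\ {morph star : x y / (x * y)%g}, involutive star
    & {in simple (c := W), forall s, star s \in simple (c := W)}].

Definition twisted_involution (star : W -> W) : {pred W} :=
  [pred w | (star w)^-1%g == w].

End Coxeter.

(* Z[u, u^-1] is realized as the subring of the field Z(X) of the fractions with
   denominator a power of X; u is the class of X. *)
Section Laurent.

Notation Xf := (tofrac ('X : {poly int})).

Definition laurent_pred : {pred {fraction {poly int}}} :=
  fun x => `[< exists (p : {poly int}) (n : nat), x = tofrac p / Xf ^+ n >].

Fact Xf_neq0 : Xf != 0.
Proof. by rewrite tofrac_eq0 polyX_eq0. Qed.

Fact laurent_subring : subring_closed laurent_pred.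
Proof.
have unitX n : Xf ^+ n \is a GRing.unit by rewrite unitrX // unitfE Xf_neq0.
split.
- by apply/asboolP; exists 1, 0%N; rewrite expr0 divr1 tofrac1.
- move=> x y /asboolP[p [m ->]] /asboolP[q [n ->]]; apply/asboolP.
  exists (p * 'X^n - q * 'X^m), (m + n)%N.
  rewrite tofracB !tofracM !tofracXn exprD invrM // mulrBl mulrA mulrK //.
  by rewrite [_ ^- n * _]mulrC mulrA mulrK.
- move=> x y /asboolP[p [m ->]] /asboolP[q [n ->]]; apply/asboolP.
  exists (p * q), (m + n)%N.
  by rewrite tofracM exprD invrM // [_^-1 * _^-1]mulrC mulrACA.
Qed.

HB.instance Definition _ :=
  GRing.isSubringClosed.Build _ laurent_pred laurent_subring.

Record laurent := Laurent {
  laurent_val : {fraction {poly int}};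
  laurent_valP : laurent_val \in laurent_pred
}.

HB.instance Definition _ := [isSub for laurent_val].
HB.instance Definition _ := [Choice of laurent by <:].
HB.instance Definition _ := [SubChoice_isSubComNzRing of laurent by <:].

Definition laurent_unit : {pred laurent} :=
  fun x => (x != 0) && ((val x)^-1 \in laurent_pred).

Definition laurent_inv (x : laurent) : laurent :=
  if x \in laurent_unit then insubd x (val x)^-1 else x.

Fact laurent_mulVx : {in laurent_unit, left_inverse 1 laurent_inv *%R}.
Proof.
move=> x Ux; have /andP[x0 Vx] := Ux.
have vx0 : val x != 0 by apply: contra_neq x0 => vx0; apply: val_inj; rewrite vx0.
have vVx : val (laurent_inv x) = (val x)^-1 by rewrite /laurent_inv Ux insubdK.
have : val (laurent_inv x) * val x = 1 by rewrite vVx mulVf.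
by rewrite -rmorphM => VxK; apply: val_inj; rewrite VxK rmorph1.
Qed.

Fact laurent_unitPl (x y : laurent) : y * x = 1 -> x \in laurent_unit.
Proof.
move=> yx1; have vyx : val y * val x = 1 by rewrite -rmorphM yx1 rmorph1.
have vx0 : val x != 0.
  by apply: contra_eq_neq vyx => ->; rewrite mulr0 eq_sym oner_neq0.
apply/andP; split; first by apply: contraNneq vx0 => ->; rewrite rmorph0.
suff -> : (val x)^-1 = val y by apply: valP.
by apply: (mulIf vx0); rewrite vyx mulVf.
Qed.

Fact laurent_inv_out : {in [predC laurent_unit], laurent_inv =1 id}.
Proof. by move=> x /negPf Ux; rewrite /laurent_inv Ux. Qed.

HB.instance Definition _ := GRing.ComNzRing_hasMulInverse.Build laurent
  laurent_mulVx laurent_unitPl laurent_inv_out.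
HB.instance Definition _ := [SubComUnitRing_isSubIntegralDomain of laurent by <:].

Fact laurentX_subproof : Xf \in laurent_pred.
Proof. by apply/asboolP; exists 'X, 0%N; rewrite expr0 divr1. Qed.

Definition u : laurent := Laurent laurentX_subproof.

Fact u_unit : u \is a GRing.unit.
Proof.
apply/andP; split.
  by rewrite -(inj_eq val_inj) rmorph0 Xf_neq0.
by apply/asboolP; exists 1, 1%N; rewrite expr1 tofrac1 mul1r.
Qed.

End Laurent.

(* [basis_on act P b]: the elements b i, for i in P, form a basis of V for the
   scalar action act.  The values of b outside P are irrelevant. *)
Definition basis_on (A : nzRingType) (V : zmodType) (act : A -> V -> V)
    (I : choiceType) (P : {pred I}) (b : I -> V) : Prop :=
  forall v, exists! c : {fsfun I -> A with 0},
    {subset finsupp c <= P} /\ v = \sum_(i <- finsupp c) act (c i) (b i).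

Section Hecke.
Variable W : coxeterSystem.

(* The inverses of the T w exist by the quadratic relation; [unitAlgType] only
   provides the notation for inverses. *)
Record is_hecke (H : unitAlgType laurent) (T : W -> H) : Prop := {
  hecke_basis : basis_on *:%R predT T;
  hecke_one : T 1%g = 1;
  hecke_mul : forall w w' : W,
    length (w * w')%g = (length w + length w')%N -> T w * T w' = T (w * w')%g;
  hecke_quad : forall s, s \in simple (c := W) ->
    (T s + 1) * (T s - (u ^+ 2)%:A) = 0
}.

Definition is_hecke_bar (H : unitAlgType laurent) (T : W -> H)
    (bar : {rmorphism H -> H}) : Prop :=
  involutive bar /\
  forall (n : int) (x : W), bar (u ^ n *: T x) = u ^ (- n) *: (T x^-1%g)^-1.

(* The ring Z[u, u^-1] acts on an H-module through c |-> c%:A.  All the indices of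
   the family a below are twisted involutions whenever w is one. *)
Record is_involution_module (star : W -> W) (H : unitAlgType laurent) (T : W -> H)
    (M : lmodType H) (a : W -> M) : Prop := {
  invol_basis :
    basis_on (fun (c : laurent) (m : M) => c%:A *: m) (twisted_involution star) a;
  invol_comm_up : forall s w,
    s \in simple (c := W) -> w \in twisted_involution star ->
    (s * w = w * star s)%g -> bruhat_lt w (s * w)%g ->
    T s *: a w = u%:A *: a w + (u + 1)%:A *: a (s * w)%g;
  invol_comm_down : forall s w,
    s \in simple (c := W) -> w \in twisted_involution star ->
    (s * w = w * star s)%g -> bruhat_lt (s * w)%g w ->
    T s *: a w = (u ^+ 2 - u - 1)%:A *: a w + (u ^+ 2 - u)%:A *: a (s * w)%g;
  invol_noncomm_up : forall s w,
    s \in simple (c := W) -> w \in twisted_involution star ->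
    (s * w <> w * star s)%g -> bruhat_lt w (s * w)%g ->
    T s *: a w = a (s * w * star s)%g;
  invol_noncomm_down : forall s w,
    s \in simple (c := W) -> w \in twisted_involution star ->
    (s * w <> w * star s)%g -> bruhat_lt (s * w)%g w ->
    T s *: a w = (u ^+ 2 - 1)%:A *: a w + (u ^+ 2)%:A *: a (s * w * star s)%g
}.

Definition is_module_bar (H : unitAlgType laurent) (bar : H -> H)
    (M : lmodType H) (a : W -> M) (barM : M -> M) : Prop :=
  [/\ forall (k : int) (x y : M), barM (x *~ k + y) = barM x *~ k + barM y,
      forall (h : H) (m : M), barM (h *: m) = bar h *: barM m
    & barM (a 1%g) = a 1%g].

End Hecke.

(* Main.v *)
Require Import Defs.
From Stdlib Require Import Relation_Operators.
From mathcomp Require Import all_boot all_order all_algebra.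
From mathcomp Require Import fraction finmap boolp.

Set Implicit Arguments.
Unset Strict Implicit.
Unset Printing Implicit Defensive.

Import GRing.Theory.

(** The formula in (b) extends to a bar-semilinear map f on M.  Put w' = w^-1 and
    let s be simple with sw > w.  If sw = ws* then s* w' = w' s, so T_{w'}
    conjugates T_s into T_{s*}, and the formula for T_{s*} a_{w'} gives
    f (T_s a_w) = bar(T_s) f (a_w).  If sw <> ws* then sws* has length l(w) + 2 by
    the exchange condition, and T_{s* w' s} = T_{s*} T_{w'} T_s gives the same
    identity.
    The vectors m with f (T_s m) = bar(T_s) f (m) are stable under T_s, because
    T_s satisfies a quadratic equation, and under division by u + 1, because M is
    torsion-free; hence the identity also holds at a_w when sw < w.
    Uniqueness follows because a_1 and the T_s reach every a_w up to powers of
    u + 1.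

    The exchange condition is derived from the presentation: the parity of the
    number of times that a reflection occurs among the inversions of a word
    depends only on the element that the word represents. *)

(** * Parity of the inversions of a word *)

Section InversionParity.
Variable W : groupType.
Implicit Types (r s t : W) (v w : seq W).
Local Open Scope group_scope.

Lemma word_prod_cons s w : word_prod (s :: w) = s * word_prod w.
Proof. by rewrite /word_prod big_cons. Qed.

Lemma word_prod_cat v w : word_prod (v ++ w) = word_prod v * word_prod w.
Proof. by rewrite /word_prod big_cat. Qed.

Lemma word_prod_flatten_nseq m w :
  word_prod (flatten (nseq m w)) = word_prod w ^+ m.
Proof.
elim: m => [|m IHm] /=; first by rewrite /word_prod big_nil.
by rewrite word_prod_cat IHm expgS.
Qed.

(* For [w = [:: s_1; ...; s_n]], the parity of the number of indices i such that
   [r] is the reflection [(s_1 ... s_(i-1)) s_i (s_1 ... s_(i-1))^-1]. *)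
Fixpoint inv_parity w r : bool :=
  if w is s :: w' then (s == r) (+) inv_parity w' (r ^ s) else false.

(** The prefix [v] conjugates every reflection attached to a letter of [w] by [word_prod v], which
    amounts to conjugating [r] the opposite way. *)
Lemma inv_parity_cat v w r :
  inv_parity (v ++ w) r = inv_parity v r (+) inv_parity w (r ^ word_prod v).
Proof.
elim: v r => [|s v IHv] r /=; first by rewrite /word_prod big_nil conjg1.
by rewrite IHv addbA word_prod_cons conjgM.
Qed.

Lemma conjg_eqV r s t : (r ^ s == t) = (r == s * t * s^-1).
Proof.
by rewrite (can2_eq (conjgK s) (conjgKV s)) /conjg invgK mulgA.
Qed.

(** The reflections of this word are, in order, s, sts, ststs, and so on: the one at position j,
    counted from 0, is (st)^j s. *)
Lemma inv_parity_alternating m s t r : s * s = 1 -> t * t = 1 ->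
  inv_parity (flatten (nseq m [:: s; t])) r =
  odd (count (fun j => r == (s * t) ^+ j * s) (iota 0 m.*2)).
Proof.
move=> ss tt; have [sV tV] := (mulg1_eq ss, mulg1_eq tt).
elim: m r => //= m IHm r; rewrite IHm /= expg0 expg1 mul1g.
rewrite -[2%N]/(2 + 0)%N iotaDl count_map !oddD !oddb.
rewrite [s == r]eq_sym [t == _]eq_sym conjg_eqV sV.
congr (_ (+) (_ (+) odd _)); apply: eq_count => j /=.
rewrite -conjgM conjg_eqV invgM sV tV.
by rewrite -[(2 + j)%N]/j.+2 expgS expgSr !mulgA.
Qed.

(** Positions j and m + j carry the same reflection because (st)^m = 1, so every reflection occurs
    an even number of times. *)
Lemma inv_parity_relation m s t r : s * s = 1 -> t * t = 1 ->
  (s * t) ^+ m = 1 -> inv_parity (flatten (nseq m [:: s; t])) r = false.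
Proof.
move=> ss tt st_m; rewrite inv_parity_alternating // -addnn iotaD count_cat.
have -> : iota (0 + m) m = map (addn m) (iota 0 m) by rewrite -iotaDl addn0.
rewrite count_map oddD.
rewrite [in X in _ (+) odd X](eq_count (a2 := fun j => r == (s * t) ^+ j * s)).
  by rewrite addbb.
by move=> j /=; rewrite expgnDr st_m mul1g.
Qed.

End InversionParity.

(** * Length, deletion and the exchange condition *)

Section Length.
Variable W : coxeterSystem.
Implicit Types (s t w z : W) (ws vs : seq W).
Local Open Scope group_scope.
Local Notation S := (simple (c := W)).
Local Notation len := (@length W).

Lemma simpleV s : s \in S -> s^-1 = s.
Proof. by move=> /simple_invol/mulg1_eq. Qed.

Lemma simpleK s w : s \in S -> s * (s * w) = w.
Proof. by move=> Ss; rewrite mulgA simple_invol // mul1g. Qed.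

Lemma simpleKr s w : s \in S -> w * s * s = w.
Proof. by move=> Ss; rewrite -mulgA simple_invol // mulg1. Qed.

(** Inserting a relator (st)^m adds 2m letters, contributes nothing to [inv_parity], and has product
    1, so it does not affect the conjugation seen by later letters. *)
Lemma word_prod_invariants vs ws :
  all (mem S) vs -> all (mem S) ws -> word_prod vs = word_prod ws ->
  odd (size vs) = odd (size ws) /\ inv_parity vs =1 inv_parity ws.
Proof.
move=> Svs Sws /(simple_presentation Svs Sws); elim=> {Svs Sws vs ws}.
- move=> v w [p [q [s [t [m [Ss St st_m -> ->]]]]]].
  have [ss tt] := (simple_invol Ss, simple_invol St).
  split=> [|r].
    rewrite !size_cat size_flatten /shape map_nseq sumn_nseq.
    by rewrite [(size _ * m)%N]mul2n !oddD odd_double.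
  rewrite !inv_parity_cat inv_parity_relation // word_prod_flatten_nseq.
  by rewrite /word_prod !big_cons big_nil mulg1 st_m conjg1.
- by [].
- by move=> v w _ [-> vw]; split.
- by move=> v w z _ [-> vw] _ [-> wz]; split=> // r; rewrite vw.
Qed.

Lemma reduced_word w :
  exists ws, [/\ all (mem S) ws, word_prod ws = w & size ws = len w].
Proof. by rewrite /len; case: ex_minnP => n /asboolP[ws Hws] _; exists ws. Qed.

Lemma length_word_prod ws : all (mem S) ws -> len (word_prod ws) <= size ws.
Proof.
move=> Sws; rewrite /len; case: ex_minnP => n _; apply.
by apply/asboolP; exists ws.
Qed.

Lemma odd_length_word_prod ws :
  all (mem S) ws -> odd (len (word_prod ws)) = odd (size ws).
Proof.
move=> Sws; have [vs [Svs vs_ws <-]] := reduced_word (word_prod ws).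
by have [] := word_prod_invariants Svs Sws vs_ws.
Qed.

Lemma length1 : len 1 = 0%N.
Proof.
have := @length_word_prod [::] isT.
by rewrite /word_prod big_nil leqn0 => /eqP.
Qed.

Lemma length_mulsl_le s w : s \in S -> len (s * w) <= (len w).+1.
Proof.
move=> Ss; have [ws [Sws <- <-]] := reduced_word w.
by rewrite -word_prod_cons (@length_word_prod (s :: ws)) //= [_ \in _]Ss.
Qed.

(** This excludes l(sw) = l(w): a simple reflection that does not raise the length lowers it. *)
Lemma odd_length_mulsl s w : s \in S -> odd (len (s * w)) = ~~ odd (len w).
Proof.
move=> Ss; have [ws [Sws <- _]] := reduced_word w.
rewrite -word_prod_cons !odd_length_word_prod //=.
by rewrite [_ \in _]Ss.
Qed.

Lemma length_mulsl_up s w : s \in S -> len w < len (s * w) ->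
  len (s * w) = (len w).+1.
Proof. by move=> Ss lt; apply/eqP; rewrite eqn_leq lt length_mulsl_le. Qed.

Lemma length_mulsl_gt s w : s \in S ->
  (len w < len (s * w)) = ~~ (len (s * w) < len w).
Proof.
move=> Ss; rewrite -leqNgt [in RHS]leq_eqVlt; case: eqP => // eq_len.
by have := odd_length_mulsl w Ss; rewrite eq_len; case: odd.
Qed.

Lemma lengthV w : len w^-1 = len w.
Proof.
suff le z : len z^-1 <= len z by apply/eqP; rewrite eqn_leq le -{1}[w]invgK le.
have [ws [Sws <- <-]] := reduced_word z.
elim: ws Sws => [_|s ws IHws /= /andP[Ss Sws]].
  by rewrite /word_prod big_nil invg1 length1.
have [vs [Svs vs_ws sz_vs]] := reduced_word (word_prod ws)^-1.
rewrite word_prod_cons invgM (simpleV Ss) -vs_ws.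
have <- : word_prod (vs ++ [:: s]) = word_prod vs * s.
  by rewrite word_prod_cat /word_prod big_seq1.
rewrite (leq_trans (length_word_prod _)) //; last first.
  by rewrite size_cat sz_vs addn1 ltnS IHws.
by rewrite all_cat Svs /= andbT.
Qed.

(** An odd count is nonzero, so r = p s p^-1 for some splitting p s q of the word; multiplying by r
    on the left then erases the letter s. *)
Lemma deletion ws r : all (mem S) ws -> inv_parity ws r ->
  exists vs, [/\ all (mem S) vs, word_prod vs = r * word_prod ws
               & size ws = (size vs).+1].
Proof.
elim: ws r => //= s ws IHws r /andP[Ss Sws].
have [<- _|_ /= /(IHws _ Sws)[vs [Svs vs_prod vs_size]]] := eqVneq s r.
  by exists ws; rewrite word_prod_cons simpleK.
exists (s :: vs); rewrite /= Svs vs_size andbT; split=> //.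
by rewrite !word_prod_cons vs_prod /conjg mulgA mulVKg mulgA.
Qed.

(** Odd parity shortens a reduced word by deletion. Conversely, prefixing s flips the parity at s,
    so even parity makes s a descent of sw, that is, w < sw. *)
Lemma inv_parity_descent ws s : all (mem S) ws -> s \in S ->
  inv_parity ws s = (len (s * word_prod ws) < len (word_prod ws)).
Proof.
move=> Sws Ss.
have descent vs : all (mem S) vs -> inv_parity vs s ->
    len (s * word_prod vs) < len (word_prod vs).
  move=> Svs; have [us [Sus us_vs us_size]] := reduced_word (word_prod vs).
  have [_ ->] := word_prod_invariants Svs Sus (esym us_vs).
  move=> /(deletion Sus)[us' [Sus' us'_prod]].
  by rewrite us_size -us_vs -us'_prod => ->; rewrite ltnS length_word_prod.
apply/idP/idP=> [/descent->//|]; apply: contraTT => no_inv.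
have := descent (s :: ws).
rewrite word_prod_cons simpleK // -length_mulsl_gt //.
by apply; rewrite /= ?Sws ?[_ \in _]Ss // eqxx /conjg mulKg.
Qed.

(** Passing from z to zt adds the single reflection z t z^-1. Since the parity at s changes, this
    reflection is s. *)
Lemma exchange_two_sided s t z : s \in S -> t \in S ->
  len z < len (s * z) -> len (s * (z * t)) < len (z * t) -> s * z = z * t.
Proof.
move=> Ss St; have [ws [Sws <- _]] := reduced_word z.
rewrite length_mulsl_gt // -inv_parity_descent // => /negPf no_inv.
have <- : word_prod (ws ++ [:: t]) = word_prod ws * t.
  by rewrite word_prod_cat /word_prod big_seq1.
rewrite -inv_parity_descent //; last by rewrite all_cat Sws /= [_ \in _]St.
rewrite inv_parity_cat no_inv /= addbF => /eqP ->.
by rewrite word_prod_cat /word_prod big_seq1 -conjgC.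
Qed.

Lemma left_descent_exists w : w <> 1 ->
  exists2 s, s \in S & len (s * w) < len w.
Proof.
have [[|s ws] [/= Sws <- len_w]] := reduced_word w.
  by rewrite /word_prod big_nil.
have /andP[Ss {}Sws] := Sws; exists s => //.
by rewrite -len_w word_prod_cons simpleK // ltnS length_word_prod.
Qed.

Lemma length_simple s : s \in S -> len s = 1%N.
Proof.
move=> Ss; have := odd_length_mulsl 1 Ss; have := length_mulsl_le 1 Ss.
by rewrite mulg1 length1; case: (len s) => [|[]].
Qed.

Lemma coxeter_length_ind (Q : W -> Prop) : Q 1 ->
    (forall s w, s \in S -> (len w < len (s * w)) -> Q w -> Q (s * w)) ->
  forall w, Q w.
Proof.
move=> Q1 QM w; have [n] := ubnP (len w).
elim: n w => // n IHn w le_wn; have [-> //|/eqP w1] := eqVneq w 1.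
have [s Ss lt] := left_descent_exists w1.
rewrite -(simpleK w Ss); apply: QM; rewrite ?simpleK //.
by apply: IHn; apply: leq_trans lt _.
Qed.

Lemma bruhat_lt_mulsl s w : s \in S -> len w < len (s * w) ->
  bruhat_lt w (s * w).
Proof.
move=> Ss lt; split=> [|eq_w]; last by rewrite -eq_w ltnn in lt.
(* Bruhat steps multiply on the right, and sw = w (w^-1 s w). *)
apply: rt_step; exists (w^-1 * s * w).
  by exists s => //; exists w^-1; rewrite invgK.
by rewrite -mulgA mulVKg.
Qed.

End Length.

(** * Coordinates and maps defined on a basis *)

Section BasisOn.
Local Open Scope fset_scope.
Local Open Scope ring_scope.
Variables (A : nzRingType) (V : zmodType) (act : A -> V -> V).
Variables (I : choiceType) (P : {pred I}) (b : I -> V).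
Hypotheses (act0 : forall v, act 0 v = 0)
  (actD : forall v, {morph act^~ v : c d / c + d >-> c + d})
  (basis_b : basis_on act P b).
Implicit Types (K : {fset I}).

Lemma finsupp_sum (U : nmodType) (f : {fsfun I -> A with 0}) K
    (F : I -> A -> U) : (forall i, F i 0 = 0) -> finsupp f `<=` K ->
  \sum_(i <- finsupp f) F i (f i) = \sum_(i <- K) F i (f i).
Proof.
by move=> F0 fK; apply: big_fset_incl => // i _ /fsfun_dflt ->.
Qed.

(** Uniqueness identifies the chosen coordinates with the coefficients of any finite expression. As
    [F i 0 = 0], zero coefficients inside [K] do no harm. *)
Lemma basis_on_extend (U : nmodType) (F : I -> A -> U) :
  (forall i, F i 0 = 0) ->
  exists g : V -> U, forall K (c : I -> A), {subset K <= P} ->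
    g (\sum_(i <- K) act (c i) (b i)) = \sum_(i <- K) F i (c i).
Proof.
move=> F0; have /choice[coord coordP] : forall v,
    exists f : {fsfun I -> A with 0},
    {subset finsupp f <= P} /\ v = \sum_(i <- finsupp f) act (f i) (b i).
  by move=> v; have [f [fP _]] := basis_b v; exists f.
exists (fun v => \sum_(i <- finsupp (coord v)) F i (coord v i)) => K c KP.
set v := \sum_(i <- K) _.
pose f : {fsfun I -> A with 0} := [fsfun i in K => c i | 0].
have fK : finsupp f `<=` K by apply: finsupp_sub.
have fE i : i \in K -> f i = c i by move=> Ki; rewrite fsfunE Ki.
have -> : coord v = f.
  have [g [_ g_uniq]] := basis_b v.
  rewrite -(g_uniq _ (coordP v)); apply: g_uniq; split.
    by move=> i /(fsubsetP fK)/KP.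
  rewrite (finsupp_sum (F := fun i x => act x (b i)) _ fK) // /v.
  by rewrite [LHS]big_seq [RHS]big_seq; apply: eq_bigr => i Ki; rewrite fE.
rewrite (finsupp_sum _ fK) //.
by rewrite [LHS]big_seq [RHS]big_seq; apply: eq_bigr => i Ki; rewrite fE.
Qed.

Lemma basis_on_fset2 v w : exists K (c d : I -> A),
  [/\ {subset K <= P}, v = \sum_(i <- K) act (c i) (b i)
    & w = \sum_(i <- K) act (d i) (b i)].
Proof.
have [f [[fP fv] _]] := basis_b v; have [g [[gP gw] _]] := basis_b w.
exists (finsupp f `|` finsupp g), f, g; split.
- by move=> i; rewrite inE => /orP[/fP|/gP].
- by rewrite fv; apply: (finsupp_sum (F := fun i x => act x (b i)));
    rewrite // fsubsetUl.
- by rewrite gw; apply: (finsupp_sum (F := fun i x => act x (b i)));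
    rewrite // fsubsetUr.
Qed.

Lemma basis_on_ind (Q : V -> Prop) :
  Q 0 -> (forall v w, Q v -> Q w -> Q (v + w)) ->
  (forall c i, i \in P -> Q (act c (b i))) -> forall v, Q v.
Proof.
move=> Q0 QD Qb v; have [f [[fP ->] _]] := basis_b v.
by rewrite big_seq; elim/big_ind: _ => // i /fP; apply: Qb.
Qed.

(** Additivity of [F] in the coefficient suffices, so semilinear extensions are covered. *)
Lemma basis_on_additive (U : nmodType) (F : I -> A -> U) :
  (forall i, F i 0 = 0) -> (forall i, {morph F i : c d / c + d >-> c + d}) ->
  exists g : V -> U, {morph g : v w / v + w >-> v + w} /\
    forall c i, i \in P -> g (act c (b i)) = F i c.
Proof.
move=> F0 FD; have [g gE] := basis_on_extend F0; exists g; split=> [v w|c i Pi].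
  have [K [c [d [KP -> ->]]]] := basis_on_fset2 v w.
  rewrite -big_split /=.
  under eq_bigr => i _ do rewrite -actD.
  rewrite (gE K (fun i => c i + d i)) // !gE // -big_split.
  by apply: eq_bigr => i _; rewrite FD.
have := gE [fset i] (fun=> c); rewrite !big_seq_fset1; apply=> j.
by rewrite inE => /eqP ->.
Qed.

Lemma basis_on_torsionfree d : GRing.lreg d ->
    (forall c v, act d (act c v) = act (d * c) v) ->
    {morph act d : v w / v + w >-> v + w} ->
  forall v, act d v = 0 -> v = 0.
Proof.
move=> d_reg actA actDr v; have [K [c [_ [KP -> _]]]] := basis_on_fset2 v v.
have act_0 : act d 0 = 0 by apply: (addIr (act d 0)); rewrite -actDr !add0r.
rewrite (big_morph _ actDr act_0).
under eq_bigr => i _ do rewrite actA.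
move=> dv0; rewrite big_seq big1 // => j Kj; suff -> : c j = 0 by [].
(* Its extension reads off the coordinate at [j]; comparing two expressions of 0 over [K] gives d
   c_j = 0. *)
pose coord_j i x : A := if i == j then x else 0.
have coord_j0 i : coord_j i 0 = 0 by rewrite /coord_j if_same.
have [g gE] := basis_on_extend coord_j0.
have := gE K (fun i => d * c i) KP; rewrite dv0.
have <- : \sum_(i <- K) act 0 (b i) = 0 by rewrite big1.
rewrite (gE K (fun=> 0)) // big1 => [|i _]; last exact: coord_j0.
rewrite (big_fsetD1 j) //= /coord_j eqxx big_seq big1 ?addr0 => [dcj|i].
  by apply: d_reg; rewrite -dcj mulr0.
by rewrite !inE => /andP[/negPf ->].
Qed.

End BasisOn.

(** * Twisted involutions and their lengths *)

Section TwistedInvolutions.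
Variables (W : coxeterSystem) (star : W -> W).
Hypothesis star_invol : diagram_involution star.
Implicit Types (s w : W).
Local Open Scope group_scope.
Local Notation S := (simple (c := W)).
Local Notation len := (@length W).
Local Notation I := (twisted_involution star).

Lemma starM : {morph star : x y / x * y}. Proof. by case: star_invol. Qed.

Lemma starK : involutive star. Proof. by case: star_invol. Qed.

Lemma star_simple s : s \in S -> star s \in S.
Proof. by case: star_invol => _ _; apply. Qed.

Lemma star1 : star 1 = 1.
Proof. by apply: (mulgI (star 1)); rewrite -starM !mulg1. Qed.

Lemma starV w : star w^-1 = (star w)^-1.
Proof. by apply/esym/mulg1_eq; rewrite -starM mulgV star1. Qed.

Lemma twisted_invol1 : 1 \in I.
Proof. by rewrite inE star1 invg1. Qed.

Lemma twisted_involE w : w \in I -> star w = w^-1.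
Proof. by rewrite inE => /eqP {2}<-; rewrite invgK. Qed.

Lemma twisted_involV w : w \in I -> w^-1 \in I.
Proof. by move=> /twisted_involE Iw; rewrite inE starV invgK Iw. Qed.

Lemma length_star w : len (star w) = len w.
Proof.
suff le z : len (star z) <= len z.
  by apply/eqP; rewrite eqn_leq le -{1}[w]starK le.
have [ws [Sws <- <-]] := reduced_word z.
rewrite /word_prod (big_morph _ starM star1) -(big_map star xpredT id).
rewrite -[X in _ <= X](size_map star) length_word_prod //.
by rewrite all_map; apply: sub_all Sws => s; apply: star_simple.
Qed.

(** The element [w * star s] is the inverse of [star (s * w)], and both operations preserve
    length. *)
Lemma length_mulr_star s w : s \in S -> w \in I ->
  len (w * star s) = len (s * w).
Proof.
move=> Ss /twisted_involE Iw.
by rewrite -lengthV invgM -starV -Iw -starM length_star simpleV.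
Qed.

Lemma twisted_invol_mulsl s w : s \in S -> w \in I -> s * w = w * star s ->
  s * w \in I.
Proof.
move=> Ss /twisted_involE Iw sw.
by rewrite inE starM Iw invgM invgK -starV simpleV // sw.
Qed.

Lemma twisted_invol_conj s w : s \in S -> w \in I -> s * w * star s \in I.
Proof.
move=> Ss /twisted_involE Iw.
by rewrite inE !starM Iw starK !invgM invgK -starV simpleV // mulgA.
Qed.

(** Turns a descent at [w] into an ascent from a shorter twisted involution [y], the form suited to
    induction on length. *)
Lemma twisted_invol_descent s w :
    s \in S -> w \in I -> len (s * w) < len w ->
  exists y, [/\ y \in I, len y < len w, len y < len (s * y) &
    s * y = y * star s /\ w = s * y \/
    s * y <> y * star s /\ w = s * y * star s].
Proof.
move=> Ss Iw lt; have Ss' := star_simple Ss.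
case: (eqVneq (s * w) (w * star s)) => [sw|/eqP sw].
  exists (s * w); rewrite simpleK //; split=> //.
    exact: twisted_invol_mulsl.
  by left; rewrite sw simpleKr.
exists (s * w * star s).
have sy : s * (s * w * star s) = w * star s by rewrite -mulgA simpleK.
(* Otherwise the exchange condition for z = sw and t = s* gives w = sws*, hence sw = ws*. *)
have lt_y : len (s * w * star s) < len (s * (s * w * star s)).
  rewrite length_mulsl_gt //; apply/negP=> /= gt; apply: sw.
  have := @exchange_two_sided _ s (star s) (s * w) Ss Ss'.
  by rewrite simpleK // => /(_ lt gt) {2}->; rewrite simpleKr.
split=> //; first exact: twisted_invol_conj.
  by apply: ltn_trans lt_y _; rewrite sy length_mulr_star.
by right; rewrite sy !simpleKr //; split=> // /esym.
Qed.

(** If s lowered the length of ws*, the exchange condition would force sw = ws*. *)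
Lemma length_twisted_conj s w :
    s \in S -> w \in I -> s * w <> w * star s -> len w < len (s * w) ->
  len (s * w * star s) = (len w).+2.
Proof.
move=> Ss Iw sw lt; have Ss' := star_simple Ss.
rewrite -mulgA length_mulsl_up //.
  by rewrite length_mulr_star // length_mulsl_up.
rewrite length_mulsl_gt //; apply/negP=> gt; apply: sw.
exact: exchange_two_sided gt.
Qed.

Lemma twisted_invol_ind (Q : W -> Prop) : Q 1 ->
    (forall s w, s \in S -> w \in I -> s * w = w * star s ->
       len w < len (s * w) -> Q w -> Q (s * w)) ->
    (forall s w, s \in S -> w \in I -> s * w <> w * star s ->
       len w < len (s * w) -> Q w -> Q (s * w * star s)) ->
  forall w, w \in I -> Q w.
Proof.
move=> Q1 Qcomm Qnoncomm w; have [n] := ubnP (len w).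
elim: n w => // n IHn w le_wn Iw; have [-> //|/eqP w1] := eqVneq w 1.
have [s Ss lt] := left_descent_exists w1.
have [y [Iy lt_yw lt_y yE]] := twisted_invol_descent Ss Iw lt.
have Qy : Q y by apply: IHn Iy; apply: leq_trans lt_yw _.
by case: yE => -[sy ->]; [apply: Qcomm | apply: Qnoncomm].
Qed.

End TwistedInvolutions.

(** * Units of the Hecke algebra and its bar involution *)

Section Hecke.
Variables (W : coxeterSystem) (H : unitAlgType laurent) (T : W -> H).
Hypothesis heckeH : is_hecke T.
Implicit Types (s w : W).
Local Open Scope ring_scope.
Local Notation S := (simple (c := W)).
Local Notation len := (@length W).

Lemma alg_comm (c : laurent) (h : H) : h * c%:A = c%:A * h.
Proof. by rewrite mulr_algl mulr_algr. Qed.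

Lemma alg_unit (c : laurent) : c \is a GRing.unit -> c%:A \is a @GRing.unit H.
Proof. exact: (rmorph_unit (in_alg H)). Qed.

Lemma hecke_sqr s : s \in S ->
  T s * T s = (u ^+ 2 - 1)%:A * T s + (u ^+ 2)%:A.
Proof.
move=> Ss; have := hecke_quad heckeH Ss.
move: (T s) (u ^+ 2) => x c; rewrite mulrDl mul1r mulrBr alg_comm addrA => q0.
apply/eqP; rewrite -subr_eq0 -q0 scalerBl scale1r mulrBl mul1r opprD opprB.
by rewrite [x - _]addrC !addrA.
Qed.

(** The quadratic relation reads T_s (T_s - (u^2 - 1)) = u^2, and u^2 is a unit. *)
Lemma hecke_simple_unit s : s \in S -> T s \is a GRing.unit.
Proof.
move=> Ss; have : T s * (T s - (u ^+ 2 - 1)%:A) \is a GRing.unit.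
  rewrite mulrBr hecke_sqr // alg_comm addrAC subrr add0r.
  by rewrite alg_unit // unitrX // u_unit.
rewrite unitrM_comm => [/andP[] //|].
by rewrite /GRing.comm mulrBr mulrBl alg_comm.
Qed.

Lemma hecke_mulsl s w : s \in S -> (len w < len (s * w)%g)%N ->
  T (s * w)%g = T s * T w.
Proof.
move=> Ss lt.
by rewrite (hecke_mul heckeH) // length_mulsl_up // (length_simple Ss).
Qed.

Lemma hecke_mulsr s w : s \in S -> (len w < len (w * s)%g)%N ->
  T (w * s)%g = T w * T s.
Proof.
move=> Ss; rewrite -lengthV -(lengthV (w * s)%g) invgM (simpleV Ss) => lt.
rewrite (hecke_mul heckeH) // -lengthV invgM (simpleV Ss) length_mulsl_up //.
by rewrite (length_simple Ss) addn1 lengthV.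
Qed.

Lemma hecke_unit w : T w \is a GRing.unit.
Proof.
elim/coxeter_length_ind: w => [|s w Ss lt Tw].
  by rewrite (hecke_one heckeH) unitr1.
by rewrite hecke_mulsl // unitrMl // hecke_simple_unit.
Qed.

Variable bar : {rmorphism H -> H}.
Hypothesis barP : is_hecke_bar T bar.

Lemma bar_hecke w : bar (T w) = (T w^-1%g)^-1.
Proof. by case: barP => _ /(_ 0 w); rewrite oppr0 expr0z !scale1r. Qed.

Lemma bar_u : bar u%:A = u^-1%:A.
Proof.
case: barP => _ /(_ 1 1%g).
by rewrite invg1 (hecke_one heckeH) invr1 expr1z -exprz_inv expr1z.
Qed.

(** Being an involution, [bar] is onto, so it sends central elements to central elements. *)
Lemma bar_alg_comm c h : bar c%:A * h = h * bar c%:A.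
Proof.
have barK : involutive bar by case: barP.
by rewrite -[h]barK -!rmorphM alg_comm.
Qed.

End Hecke.

(** * The bar operator on the module: uniqueness and construction *)

Section BarOperator.
Variables (W : coxeterSystem) (star : W -> W).
Hypothesis star_invol : diagram_involution star.
Variables (H : unitAlgType laurent) (T : W -> H).
Hypothesis heckeH : is_hecke T.
Variable bar : {rmorphism H -> H}.
Hypothesis barP : is_hecke_bar T bar.
Variables (M : lmodType H) (a : W -> M).
Hypothesis moduleM : is_involution_module star T a.
Implicit Types (s w : W) (m : M).
Local Open Scope ring_scope.
Local Notation S := (simple (c := W)).
Local Notation len := (@length W).
Local Notation I := (twisted_involution star).
Local Notation act := (fun (c : laurent) m => c%:A *: m).

Lemma invol_module_torsionfree (c : laurent) m :
  c != 0 -> c%:A *: m = 0 -> m = 0.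
Proof.
move=> c0; have act0 m' : act 0 m' = 0 by rewrite /= !scale0r.
apply: (basis_on_torsionfree act0 (invol_basis moduleM) (d := c)).
- exact/lregP.
- by move=> d v; rewrite /= scalerA -scalerAl mul1r scalerA.
- by move=> x y; rewrite /= scalerDr.
Qed.

(** This is the bar of u + 1, the factor cancelled later by torsion-freeness. *)
Lemma u_addV1 : u^-1 + 1 != 0.
Proof.
have -> : u^-1 + 1 = u^-1 * (u + 1).
  by rewrite mulrDr mulVr ?u_unit // mulr1 addrC.
rewrite mulf_neq0 ?invr_eq0 //.
  by apply: contraTneq u_unit => ->; rewrite unitr0.
rewrite -(inj_eq val_inj) raddfD raddf0 /= -tofrac1 -tofracD tofrac_eq0.
by rewrite -size_poly_eq0 size_XaddC.
Qed.

Lemma bar_uD1 : bar (u + 1)%:A = (u^-1 + 1)%:A.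
Proof. by rewrite !scalerDl !scale1r rmorphD rmorph1 (bar_u heckeH barP). Qed.

(** The right-hand side of (b), prescribed as the image of [a w]. *)
Definition bar_basis w : M := ((-1) ^+ len w * (T w^-1%g)^-1) *: a w^-1%g.

Lemma bar_basisE w : bar_basis w =
  if odd (len w) then - ((T w^-1%g)^-1 *: a w^-1%g)
  else (T w^-1%g)^-1 *: a w^-1%g.
Proof.
rewrite /bar_basis -signr_odd; case: odd; last by rewrite expr0 mul1r.
by rewrite expr1 mulN1r scaleNr.
Qed.

Lemma bar_basis1 : bar_basis 1%g = a 1%g.
Proof.
by rewrite bar_basisE length1 invg1 (hecke_one heckeH) invr1 scale1r.
Qed.

Lemma bar_simple s : s \in S -> bar (T s) = (T s)^-1.
Proof. by move=> Ss; rewrite (bar_hecke barP) simpleV. Qed.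

Lemma alg_scale_comm (c : laurent) (h : H) m :
  c%:A *: (h *: m) = h *: (c%:A *: m).
Proof. by rewrite !scalerA alg_comm. Qed.

(** As [w^-1 = star w], the product on the right is [star (s * w)]. *)
Lemma invol_lengthV_up s w : s \in S -> w \in I -> (len w < len (s * w)%g)%N ->
  (len w^-1%g < len (star s * w^-1)%g)%N.
Proof.
move=> Ss Iw lt.
by rewrite -(twisted_involE Iw) -(starM star_invol) !(length_star star_invol).
Qed.

(** This is what T_s a_w = u a_w + (u + 1) a_{sw} becomes under the prescribed map. *)
Lemma bar_basis_comm_up s w : s \in S -> w \in I -> (s * w = w * star s)%g ->
    (len w < len (s * w)%g)%N ->
  u^-1%:A *: bar_basis w + (u^-1 + 1)%:A *: bar_basis (s * w)%g =
  (T s)^-1 *: bar_basis w.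
Proof.
move=> Ss Iw sw lt; have Ss' := star_simple star_invol Ss.
have Us := hecke_simple_unit heckeH Ss; have Uw := hecke_unit heckeH w^-1.
have lt' := invol_lengthV_up Ss Iw lt.
have sw' : (star s * w^-1 = w^-1 * s)%g.
  by apply: invg_inj; rewrite !invgM invgK !simpleV.
have Tsw : T (s * w)^-1%g = T w^-1%g * T s.
  by rewrite invgM (simpleV Ss) (hecke_mulsr heckeH) // -sw'.
(* With w' = w^-1, both T_{w'} T_s and T_{s*} T_{w'} equal T_{(sw)^-1}. *)
have XT : (T w^-1%g)^-1 * T (star s) = T s * (T w^-1%g)^-1.
  apply: (mulrI Uw); rewrite mulrA divrr // mul1r mulrA -Tsw.
  by rewrite invgM (simpleV Ss) -sw' (hecke_mulsl heckeH) // mulrK.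
have Ta : T (star s) *: a w^-1%g =
    u%:A *: a w^-1%g + (u + 1)%:A *: a (star s * w^-1)%g.
  apply: (invol_comm_up moduleM) => //.
  - exact: (twisted_involV star_invol).
  - by rewrite starK.
  - exact: bruhat_lt_mulsl.
have {}Ta : (u^-1 + 1)%:A *: a (s * w)^-1%g =
    u^-1%:A *: (T (star s) *: a w^-1%g) - a w^-1%g.
  rewrite Ta invgM (simpleV Ss) -sw' scalerDr !scalerA -!scalerAl !mul1r.
  rewrite !scalerA mulrDr mulVr ?u_unit // mulr1 [1 + _]addrC scale1r scale1r.
  by rewrite addrAC subrr add0r.
rewrite !bar_basisE odd_length_mulsl // Tsw invrM // -scalerA.
set x := (T w^-1%g)^-1 *: a w^-1%g.
(* Since w and sw have opposite signs, the terms u^-1 x cancel in the goal and T_s^-1 x remains. *)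
have E : (u^-1 + 1)%:A *: ((T s)^-1 *: ((T w^-1%g)^-1 *: a (s * w)^-1%g)) =
    u^-1%:A *: x - (T s)^-1 *: x.
  rewrite !(alg_scale_comm (u^-1 + 1)) Ta !scalerBr -!(alg_scale_comm u^-1).
  rewrite [_ *: (T (star s) *: _)]scalerA XT -scalerA scalerA mulVr //.
  by rewrite scale1r.
case: odd; rewrite /= !scalerN E ?addKr //.
by rewrite opprB addrC subrK.
Qed.

(** The factor T_{s*} in T_{s*} T_{w'} T_s cancels against a_{s* w' s} = T_{s*} a_{w'}, where w' =
    w^-1. The signs agree because the length grows by 2. *)
Lemma bar_basis_noncomm_up s w :
    s \in S -> w \in I -> (s * w <> w * star s)%g ->
    (len w < len (s * w)%g)%N ->
  bar_basis (s * w * star s)%g = (T s)^-1 *: bar_basis w.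
Proof.
move=> Ss Iw sw lt; have Ss' := star_simple star_invol Ss.
have Us := hecke_simple_unit heckeH Ss; have Uw := hecke_unit heckeH w^-1.
have Us' := hecke_simple_unit heckeH Ss'.
have lt' := invol_lengthV_up Ss Iw lt.
have sw' : (star s * w^-1 <> w^-1 * s)%g.
  move=> /(congr1 (@monoid.inv W)).
  by rewrite !invgM invgK !simpleV // => /esym.
have wE : ((s * w * star s)^-1 = star s * w^-1 * s)%g.
  by rewrite !invgM (simpleV Ss) (simpleV Ss') monoid.mulgA.
have len_sws := length_twisted_conj star_invol Ss Iw sw lt.
have Tsws : T (s * w * star s)^-1%g = T (star s) * T w^-1%g * T s.
  rewrite wE (hecke_mulsr heckeH) // ?(hecke_mulsl heckeH) //.
  by rewrite -wE lengthV len_sws length_mulsl_up // lengthV.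
have Ta : a (s * w * star s)^-1%g = T (star s) *: a w^-1%g.
  rewrite wE (invol_noncomm_up moduleM) ?starK //.
    exact: (twisted_involV star_invol).
  exact: bruhat_lt_mulsl.
rewrite !bar_basisE len_sws /= negbK Ta Tsws !invrM ?unitrMl // -!scalerA.
rewrite [_ *: (T (star s) *: _)]scalerA mulVr // scale1r.
by case: odd; rewrite ?scalerN.
Qed.

Lemma module_bar_uniq (f g : M -> M) :
  is_module_bar bar a f -> is_module_bar bar a g -> f = g.
Proof.
move=> [fD fZ f1] [gD gZ g1].
have {}fD : {morph f : x y / x + y}.
  by move=> x y; have := fD 1 x y; rewrite !mulr1z.
have {}gD : {morph g : x y / x + y}.
  by move=> x y; have := gD 1 x y; rewrite !mulr1z.
have f0 : f 0 = 0 by rewrite -[X in f X](scale0r 0) fZ rmorph0 scale0r.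
have g0 : g 0 = 0 by rewrite -[X in g X](scale0r 0) gZ rmorph0 scale0r.
have fga w : w \in I -> f (a w) = g (a w).
  move: w; apply: (twisted_invol_ind star_invol); first by rewrite f1 g1.
    move=> s w Ss Iw sw lt fgw; apply/eqP; rewrite -subr_eq0; apply/eqP.
    apply: (invol_module_torsionfree u_addV1).
    rewrite scalerBr -bar_uD1 -fZ -gZ.
    (* Only (u + 1) a_{sw} is reached from a_w, whence the earlier multiplication by u^-1 + 1. *)
    have -> : (u + 1)%:A *: a (s * w)%g = T s *: a w + (- u%:A) *: a w.
      rewrite (invol_comm_up moduleM) //; last exact: bruhat_lt_mulsl.
      by rewrite scaleNr addrAC subrr add0r.
    by rewrite fD gD !fZ !gZ fgw subrr.
  move=> s w Ss Iw sw lt fgw.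
  rewrite -(invol_noncomm_up moduleM) //; last exact: bruhat_lt_mulsl.
  by rewrite fZ gZ fgw.
apply/funext => m; move: m.
apply: (basis_on_ind (invol_basis moduleM)) => [|x y|c w Iw].
- by rewrite f0 g0.
- by rewrite fD gD => -> ->.
- by rewrite fZ gZ fga.
Qed.

Lemma module_bar_exists : exists f : M -> M,
  [/\ {morph f : x y / x + y}, forall h m, f (h *: m) = bar h *: f m
    & {in I, forall w, f (a w) = bar_basis w}].
Proof.
have act0 m : act 0 m = 0 by rewrite /= !scale0r.
have actD m : {morph act^~ m : c d / c + d >-> c + d}.
  by move=> c d; rewrite /= !scalerDl.
have [||f [fD fE]] := basis_on_additive act0 actD (invol_basis moduleM)
    (F := fun w c => bar c%:A *: bar_basis w).
- by move=> w; rewrite scale0r rmorph0 scale0r.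
- by move=> w c d; rewrite scalerDl rmorphD scalerDl.
have faE c w : w \in I -> f (c%:A *: a w) = bar c%:A *: bar_basis w.
  exact: fE.
have fa : {in I, forall w, f (a w) = bar_basis w}.
  by move=> w Iw; have := faE 1 w Iw; rewrite !scale1r rmorph1 scale1r.
have f0 : f 0 = 0.
  by apply: (addIr (f 0)); rewrite -fD !add0r.
have fc c m : f (c%:A *: m) = bar c%:A *: f m.
  move: m; apply: (basis_on_ind (invol_basis moduleM)) => [|x y|d w Iw].
  - by rewrite scaler0 f0 scaler0.
  - by rewrite scalerDr !fD scalerDr => -> ->.
  - rewrite (faE d) // !scalerA -rmorphM -scalerAl mul1r scalerA faE //.
    by rewrite /bar_basis scalerA.
exists f; split=> //.
(* So far f is semilinear over the scalars only. The vectors where it respects T_s are shown to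
   contain every a_w. *)
pose D s m := f (T s *: m) = bar (T s) *: f m.
have DD s m n : D s m -> D s n -> D s (m + n).
  by rewrite /D => Dm Dn; rewrite scalerDr !fD scalerDr Dm Dn.
have Dc s c m : D s m -> D s (c%:A *: m).
  rewrite /D => Dm; rewrite scalerA alg_comm -scalerA !fc Dm !scalerA.
  by rewrite (bar_alg_comm barP).
(* T_s^2 is a scalar combination of T_s and 1, and f already respects both at m. *)
have DT s m : s \in S -> D s m -> D s (T s *: m).
  rewrite /D => Ss Dm; rewrite Dm !scalerA -rmorphM (hecke_sqr heckeH Ss).
  move: (u ^+ 2 - 1) => c; move: (u ^+ 2) => d.
  rewrite scalerDl -scalerA fD !fc Dm scalerA -rmorphM -scalerDl.
  by rewrite -rmorphD.
have D_up s w : s \in S -> w \in I -> (len w < len (s * w)%g)%N -> D s (a w).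
  move=> Ss Iw lt; rewrite /D bar_simple // fa //.
  have [sw|/eqP sw] := eqVneq (s * w)%g (w * star s)%g.
    rewrite (invol_comm_up moduleM) ?fD ?fc ?fa //; last exact: bruhat_lt_mulsl.
      by rewrite bar_uD1 (bar_u heckeH barP) bar_basis_comm_up.
    exact: (twisted_invol_mulsl star_invol).
  rewrite (invol_noncomm_up moduleM) ?fa ?bar_basis_noncomm_up //.
    exact: (twisted_invol_conj star_invol).
  exact: bruhat_lt_mulsl.
have Da s w : s \in S -> w \in I -> D s (a w).
  move=> Ss Iw; have [lt|] := boolP (len w < len (s * w)%g)%N.
    exact: D_up.
  rewrite length_mulsl_gt // negbK => lt.
  have [y [Iy _ lt_y]] := twisted_invol_descent star_invol Ss Iw lt.
  have Dy := D_up s y Ss Iy lt_y.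
  case=> -[sy ->]; last first.
    rewrite -(invol_noncomm_up moduleM) //; last exact: bruhat_lt_mulsl.
    exact: DT.
  (* This vector is T_s a_y - u a_y, built from a_y by operations preserving [D s]; then u^-1 + 1 is
     cancelled. *)
  have : D s ((u + 1)%:A *: a (s * y)%g).
    have -> : (u + 1)%:A *: a (s * y)%g = T s *: a y + (- u)%:A *: a y.
      rewrite (invol_comm_up moduleM) //; last exact: bruhat_lt_mulsl.
      by rewrite !scaleNr addrAC subrr add0r.
    by apply: DD; [apply: DT | apply: Dc].
  rewrite /D scalerA alg_comm -scalerA !fc => Duy.
  apply/eqP; rewrite -subr_eq0; apply/eqP.
  apply: (invol_module_torsionfree u_addV1).
  by rewrite -bar_uD1 scalerBr Duy !scalerA (bar_alg_comm barP) subrr.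
have fTs s m : s \in S -> f (T s *: m) = bar (T s) *: f m.
  move=> Ss; move: m.
  apply: (basis_on_ind (invol_basis moduleM)) => [|x y|c w Iw].
  - by rewrite scaler0 f0 scaler0.
  - exact: DD.
  - by apply: Dc; apply: Da.
have fT w m : f (T w *: m) = bar (T w) *: f m.
  elim/coxeter_length_ind: w => [|s w Ss lt IHw].
    by rewrite (hecke_one heckeH) rmorph1 !scale1r.
  by rewrite (hecke_mulsl heckeH) // rmorphM -!scalerA fTs // IHw.
move=> h m; move: h.
apply: (basis_on_ind (hecke_basis heckeH)) => [|g h fg fh|c w _].
- by rewrite rmorph0 !scale0r.
- by rewrite rmorphD !scalerDl fD fg fh.
- by rewrite -mulr_algl rmorphM -!scalerA fc fT.
Qed.

End BarOperator.

(** * Existence, uniqueness, involutivity and the formula on the basis *)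

Local Open Scope ring_scope.

Theorem theorem0p2 (W : coxeterSystem) (star : W -> W)
    (star_invol : diagram_involution star)
    (H : unitAlgType laurent) (T : W -> H) (heckeH : is_hecke T)
    (bar : {rmorphism H -> H}) (barP : is_hecke_bar T bar)
    (M : lmodType H) (a : W -> M) (moduleM : is_involution_module star T a) :
  exists barM : M -> M,
    [/\ unique (is_module_bar bar a) barM,
        involutive barM
      & forall w : W, w \in twisted_involution star ->
          barM (a w) = ((-1) ^+ length w * (T w^-1%g)^-1) *: a w^-1%g].
Proof.
have [f [fD fZ fa]] := module_bar_exists star_invol heckeH barP moduleM.
have f0 : f 0 = 0 by apply: (addIr (f 0)); rewrite -fD !add0r.
have f1 : f (a 1%g) = a 1%g.
  by rewrite fa ?(bar_basis1 heckeH) // (twisted_invol1 star_invol).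
have fN x : f (- x) = - f x by apply: (addIr (f x)); rewrite -fD !addNr.
have fz k x : f (x *~ k) = f x *~ k.
  have fn n : f (x *+ n) = f x *+ n.
    by elim: n => [|n IHn]; rewrite ?mulr0n // !mulrS fD IHn.
  by case: k => n; rewrite ?NegzE ?mulrNz ?fN -?pmulrn fn.
have fbar : is_module_bar bar a f by split=> // k x y; rewrite fD fz.
exists f; split=> //.
  by split=> // g gbar; apply: (module_bar_uniq star_invol heckeH barP moduleM).
have [barK _] := barP.
(* The bar of T_{w^-1}^-1 is T_w, which cancels the T_w^-1 in the image of a_{w^-1}; the two equal
   signs multiply to 1. *)
have ffa w : w \in twisted_involution star -> f (f (a w)) = a w.
  move=> Iw; rewrite fa // /bar_basis fZ fa ?(twisted_involV star_invol) //.
  rewrite rmorphM rmorphXn rmorphN1 rmorphV ?(hecke_unit heckeH) //.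
  rewrite (bar_hecke barP) invrK /bar_basis invgK lengthV scalerA.
  rewrite -(commr_sign (T w)) mulrA -[T w * _ * _]mulrA -expr2 sqrr_sign mulr1.
  by rewrite divrr ?(hecke_unit heckeH) // scale1r.
(* As [bar] is an involution, f composed with itself is linear, so the basis decides. *)
apply: (basis_on_ind (invol_basis moduleM)) => [|x y fx fy|c w Iw].
- by rewrite !f0.
- by rewrite !fD fx fy.
- by rewrite !fZ barK ffa.
Qed.
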